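(* Let $\mathsf{C}$ be an a.s.-compatibly representable Markov category with conditionals, and let $\Theta$ be a discrete object of $\mathsf{C}$ with respect to $m\colon I\to\Theta$. Consider two morphisms $f\colon\Theta\to X$ and $g\colon\Theta\to Y$ in $\mathsf{C}$, with standard experiments $\hat f,\hat g\colon\Theta\to P\Theta$ and standard measures $\hat f_m,\hat g_m\colon I\to P\Theta$ (with respect to $m$). Then the following are equivalent: 1. $f\succeq g$, i.e. there exists a morphism $c\colon X\to Y$ such that $c\circ f=g$. 2. $\hat g_m$ second-order dominates $\hat f_m$, i.e. there exists a $\hat g_m$-dilation $t\colon P\Theta\to P\Theta$ such that $\hat f_m=t\circ\hat g_m$.
   Context: Coherence isomorphisms of monoidal categories are suppressed. A Markov category is a symmetric monoidal category $(\mathsf{C},\otimes,I)$ whose unit $I$ is terminal (write $\mathrm{del}_X \colon X \to I$), in which every object $X$ carries a distinguished morphism $\mathrm{copy}_X \colon X \to X\otimes X$ making $(X,\mathrm{copy}_X,\mathrm{del}_X)$ a commutative comonoid, and such that $\mathrm{copy}_{X\otimes Y} = (\mathrm{id}_X\otimes \mathrm{swap}_{X,Y}\otimes \mathrm{id}_Y)\circ(\mathrm{copy}_X\otimes \mathrm{copy}_Y)$. A morphism $f\colon X\to Y$ is deterministic if $\mathrm{copy}_Y\circ f=(f\otimes f)\circ \mathrm{copy}_X$; deterministic morphisms form a subcategory $\mathsf{C}_{\det}$. Conditionals: a conditional of $f\colon A\to X\otimes Y$ with respect to $X$ is a morphism $f_{|X}\colon X\otimes A\to Y$ with $f=(\mathrm{id}_X\otimes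 f_{|X})\circ(\mathrm{copy}_X\otimes \mathrm{id}_A)\circ(((\mathrm{id}_X\otimes \mathrm{del}_Y)\circ f)\otimes \mathrm{id}_A)\circ \mathrm{copy}_A$. $\mathsf{C}$ has conditionals if these exist for all such $f$. Bayesian inverse of $f\colon \Theta\to X$ with respect to $m\colon I\to \Theta$: a morphism $f^\dagger\colon X\to \Theta$ with $(f\otimes \mathrm{id}_\Theta)\circ \mathrm{copy}_\Theta\circ m=(\mathrm{id}_X\otimes f^\dagger)\circ \mathrm{copy}_X\circ f\circ m$. Almost sure equality: for $h\colon A\to X$ and $f,g\colon X\to Y$, write $f=_{h\text{-a.s.}}g$ if $(\mathrm{id}_X\otimes f)\circ \mathrm{copy}_X\circ h=(\mathrm{id}_X\otimes g)\circ \mathrm{copy}_X\circ h$. Discreteness: $\Theta$ is discrete with respect to $m\colon I\to\Theta$ if for every object $A$ and all $f,g\colon\Theta\to A$, $f=_{m\text{-a.s.}}g$ if and only if $f=g$. Representability: $\mathsf{C}$ is representable if every object $X$ has a distribution object, i.e. an object $PX$ with a morphism $\mathrm{samp}_X\colon PX\to X$ such that $\mathrm{samp}_X\circ -\colon \mathsf{C}_{\det}(A,PX)\to\mathsf{C}(A,X)$ is a bijection for all $A$. Its inverse is written $f\mapsto f^\sharp$. $P$ is a functor $\mathsf{C}\to\mathsf{C}_{\det}$, where for $f\colon X\to Y$, $Pf=(f\circ\mathrm{samp}_X)^\sharp$. $\mathsf{C}$ is a.s.-compatibly representable if it is representable and for all $p\colon B\to A$ and $f,g\colon A\to X$: $f^\sharp=_{p\text{-a.s.}}g^\sharp$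 if and only if $f=_{p\text{-a.s.}}g$. Standard experiment and standard measure of $f\colon\Theta\to X$ (with respect to $m$): $\hat f:=(f^\dagger)^\sharp\circ f\colon\Theta\to P\Theta$, for a Bayesian inverse $f^\dagger$ of $f$ with respect to $m$ (unique up to $m$-a.s. equality), and $\hat f_m:=\hat f\circ m$. Dilation: for $q\colon I\to P\Theta$, a morphism $t\colon P\Theta\to P\Theta$ is a $q$-dilation (with respect to the free $P$-algebra structure $P(\mathrm{samp}_\Theta)\colon PP\Theta\to P\Theta$) if $P(\mathrm{samp}_\Theta)\circ t^\sharp=_{q\text{-a.s.}}\mathrm{id}_{P\Theta}$. *)

(* Defs.v *)
Set Implicit Arguments.
Unset Strict Implicit.
Unset Printing Implicit Defensive.

Declare Scope markov_scope.
Delimit Scope markov_scope with markov.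
Open Scope markov_scope.

Reserved Notation "X ~> Y" (at level 60, no associativity).
Reserved Notation "g ∘ f" (at level 50, left associativity).
Reserved Notation "X ⊗ Y" (at level 40, left associativity).
Reserved Notation "f ⊠ g" (at level 40, left associativity).

Record category := Category {
  obj :> Type;
  hom : obj -> obj -> Type
    where "X ~> Y" := (hom X Y);
  idm : forall X, X ~> X;
  comp : forall X Y Z, Y ~> Z -> X ~> Y -> X ~> Z
    where "g ∘ f" := (comp g f);
  comp_idl : forall X Y (f : X ~> Y), idm Y ∘ f = f;
  comp_idr : forall X Y (f : X ~> Y), f ∘ idm X = f;
  comp_assoc : forall W X Y Z (h : Y ~> Z) (g : X ~> Y) (f : W ~> X),
    h ∘ (g ∘ f) = (h ∘ g) ∘ f
}.

Arguments idm {c} X.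
Notation "X ~> Y" := (hom X Y) : markov_scope.
Notation "g ∘ f" := (comp g f) : markov_scope.

(* Monoidal categories are not assumed strict: the coherence isomorphisms are
   part of the structure.  [⊗] is the tensor of objects, [⊠] that of
   morphisms. *)
Record monoidal_category := MonoidalCategory {
  mon_cat :> category;
  unit_obj : mon_cat;
  tensor : mon_cat -> mon_cat -> mon_cat
    where "X ⊗ Y" := (tensor X Y);
  tensor_hom : forall X X' Y Y' : mon_cat,
    X ~> X' -> Y ~> Y' -> X ⊗ Y ~> X' ⊗ Y'
    where "f ⊠ g" := (tensor_hom f g);
  tensor_id : forall X Y : mon_cat, idm X ⊠ idm Y = idm (X ⊗ Y);
  tensor_comp : forall (X X' X'' Y Y' Y'' : mon_cat)
      (f' : X' ~> X'') (f : X ~> X') (g' : Y' ~> Y'') (g : Y ~> Y'),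
    (f' ∘ f) ⊠ (g' ∘ g) = (f' ⊠ g') ∘ (f ⊠ g);

  assoc : forall X Y Z : mon_cat, (X ⊗ Y) ⊗ Z ~> X ⊗ (Y ⊗ Z);
  assoc_inv : forall X Y Z : mon_cat, X ⊗ (Y ⊗ Z) ~> (X ⊗ Y) ⊗ Z;
  assocK : forall X Y Z, assoc_inv X Y Z ∘ assoc X Y Z = idm _;
  assoc_invK : forall X Y Z, assoc X Y Z ∘ assoc_inv X Y Z = idm _;
  assoc_nat : forall (X X' Y Y' Z Z' : mon_cat)
      (f : X ~> X') (g : Y ~> Y') (h : Z ~> Z'),
    assoc X' Y' Z' ∘ ((f ⊠ g) ⊠ h) = (f ⊠ (g ⊠ h)) ∘ assoc X Y Z;

  lunit : forall X : mon_cat, unit_obj ⊗ X ~> X;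
  lunit_inv : forall X : mon_cat, X ~> unit_obj ⊗ X;
  lunitK : forall X, lunit_inv X ∘ lunit X = idm _;
  lunit_invK : forall X, lunit X ∘ lunit_inv X = idm _;
  lunit_nat : forall (X X' : mon_cat) (f : X ~> X'),
    lunit X' ∘ (idm unit_obj ⊠ f) = f ∘ lunit X;

  runit : forall X : mon_cat, X ⊗ unit_obj ~> X;
  runit_inv : forall X : mon_cat, X ~> X ⊗ unit_obj;
  runitK : forall X, runit_inv X ∘ runit X = idm _;
  runit_invK : forall X, runit X ∘ runit_inv X = idm _;
  runit_nat : forall (X X' : mon_cat) (f : X ~> X'),
    runit X' ∘ (f ⊠ idm unit_obj) = f ∘ runit X;

  triangle : forall X Y : mon_cat,
    (idm X ⊠ lunit Y) ∘ assoc X unit_obj Y = runit X ⊠ idm Y;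
  pentagon : forall W X Y Z : mon_cat,
    assoc W X (Y ⊗ Z) ∘ assoc (W ⊗ X) Y Z
    = (idm W ⊠ assoc X Y Z) ∘ assoc W (X ⊗ Y) Z ∘ (assoc W X Y ⊠ idm Z)
}.

Arguments unit_obj {m}.
Arguments assoc {m} X Y Z.
Arguments assoc_inv {m} X Y Z.
Arguments lunit {m} X.
Arguments lunit_inv {m} X.
Arguments runit {m} X.
Arguments runit_inv {m} X.
Notation "X ⊗ Y" := (tensor X Y) : markov_scope.
Notation "f ⊠ g" := (tensor_hom f g) : markov_scope.

Record symmetric_monoidal_category := SymmetricMonoidalCategory {
  sym_mon :> monoidal_category;
  swap : forall X Y : sym_mon, X ⊗ Y ~> Y ⊗ X;
  swap_nat : forall (X X' Y Y' : sym_mon) (f : X ~> X') (g : Y ~> Y'),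
    swap X' Y' ∘ (f ⊠ g) = (g ⊠ f) ∘ swap X Y;
  swapK : forall X Y, swap Y X ∘ swap X Y = idm _;
  hexagon : forall X Y Z : sym_mon,
    assoc Y Z X ∘ swap X (Y ⊗ Z) ∘ assoc X Y Z
    = (idm Y ⊠ swap X Z) ∘ assoc Y X Z ∘ (swap X Y ⊠ idm Z)
}.

Arguments swap {s} X Y.

(* id ⊗ swap ⊗ id, with its coherence isomorphisms. *)
Definition swap_mid (C : symmetric_monoidal_category) (X Y : C) :
    (X ⊗ X) ⊗ (Y ⊗ Y) ~> (X ⊗ Y) ⊗ (X ⊗ Y) :=
  assoc_inv X Y (X ⊗ Y)
  ∘ (idm X ⊠ (assoc Y X Y ∘ (swap X Y ⊠ idm Y) ∘ assoc_inv X Y Y))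
  ∘ assoc X X (Y ⊗ Y).

Record markov_category := MarkovCategory {
  markov_sym :> symmetric_monoidal_category;
  del : forall X : markov_sym, X ~> unit_obj;
  del_unique : forall (X : markov_sym) (f : X ~> unit_obj), f = del X;
  copy : forall X : markov_sym, X ~> X ⊗ X;
  copy_assoc : forall X : markov_sym,
    assoc X X X ∘ (copy X ⊠ idm X) ∘ copy X = (idm X ⊠ copy X) ∘ copy X;
  copy_lunit : forall X : markov_sym,
    lunit X ∘ (del X ⊠ idm X) ∘ copy X = idm X;
  copy_runit : forall X : markov_sym,
    runit X ∘ (idm X ⊠ del X) ∘ copy X = idm X;
  copy_comm : forall X : markov_sym, swap X X ∘ copy X = copy X;
  copy_tensor : forall X Y : markov_sym,
    copy (X ⊗ Y) = swap_mid X Y ∘ (copy X ⊠ copy Y)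
}.

Arguments del {m} X.
Arguments copy {m} X.

Section Notions.
Variable C : markov_category.

Definition deterministic (X Y : C) (f : X ~> Y) : Prop :=
  copy Y ∘ f = (f ⊠ f) ∘ copy X.

Definition is_conditional (A X Y : C) (f : A ~> X ⊗ Y) (k : X ⊗ A ~> Y) :
    Prop :=
  f = (idm X ⊠ k) ∘ assoc X X A ∘ (copy X ⊠ idm A)
      ∘ ((runit X ∘ (idm X ⊠ del Y) ∘ f) ⊠ idm A) ∘ copy A.

Definition has_conditionals : Prop :=
  forall (A X Y : C) (f : A ~> X ⊗ Y),
    exists k : X ⊗ A ~> Y, is_conditional f k.

Definition is_bayesian_inverse (Theta X : C) (m : unit_obj ~> Theta)
    (f : Theta ~> X) (f' : X ~> Theta) : Prop :=
  (f ⊠ idm Theta) ∘ copy Theta ∘ m = (idm X ⊠ f') ∘ copy X ∘ f ∘ m.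

Definition as_eq (A X Y : C) (h : A ~> X) (f g : X ~> Y) : Prop :=
  (idm X ⊠ f) ∘ copy X ∘ h = (idm X ⊠ g) ∘ copy X ∘ h.

Definition discrete (Theta : C) (m : unit_obj ~> Theta) : Prop :=
  forall (A : C) (f g : Theta ~> A), as_eq m f g <-> f = g.

(* A choice of distribution object for every object.  The last three fields say
   that [sharp] is inverse to the map g ↦ samp ∘ g from deterministic morphisms
   A ~> P X to all morphisms A ~> X. *)
Record representation := Representation {
  P : C -> C;
  samp : forall X : C, P X ~> X;
  sharp : forall A X : C, A ~> X -> A ~> P X;
  sharp_det : forall (A X : C) (f : A ~> X), deterministic (sharp f);
  sharpK : forall (A X : C) (f : A ~> X), samp X ∘ sharp f = f;
  sampK : forall (A X : C) (g : A ~> P X),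
    deterministic g -> sharp (samp X ∘ g) = g
}.

Variable R : representation.

Definition as_compatible : Prop :=
  forall (B A X : C) (p : B ~> A) (f g : A ~> X),
    as_eq p (sharp R f) (sharp R g) <-> as_eq p f g.

Definition P_hom (X Y : C) (f : X ~> Y) : P R X ~> P R Y :=
  sharp R (f ∘ samp R X).

(* The standard experiment is only determined through a choice of Bayesian
   inverse, so it is a relation. *)
Definition is_standard_experiment (Theta X : C) (m : unit_obj ~> Theta)
    (f : Theta ~> X) (fhat : Theta ~> P R Theta) : Prop :=
  exists f' : X ~> Theta,
    is_bayesian_inverse m f f' /\ fhat = sharp R f' ∘ f.

Definition is_dilation (Theta : C) (q : unit_obj ~> P R Theta)
    (t : P R Theta ~> P R Theta) : Prop :=
  as_eq q (P_hom (samp R Theta) ∘ sharp R t) (idm (P R Theta)).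

Definition second_order_dominates (Theta : C) (q p : unit_obj ~> P R Theta) :
    Prop :=
  exists t : P R Theta ~> P R Theta, is_dilation q t /\ p = t ∘ q.

Definition more_informative (Theta X Y : C) (f : Theta ~> X) (g : Theta ~> Y) :
    Prop :=
  exists c : X ~> Y, c ∘ f = g.

End Notions.

(* Main.v *)
From Corelib Require Import ssreflect.
Require Import Defs.

Set Implicit Arguments.
Unset Strict Implicit.
Unset Printing Implicit Defensive.

(* In a joint state of the parameter and the observation one may pass to
   Bayesian inverses.  The standard experiment [fhat] has [samp] as a Bayesian
   inverse, and it is a sufficient statistic: inverting the statistic [f'^sharp]
   recovers [f] from [fhat] up to m-a.s. equality, hence exactly when [Theta] is
   discrete.  So [f] and [fhat] are equally informative.  A kernel [k] with
   [k o fhat = ghat] and a dilation [t] with [t o ghat_m = fhat_m] are Bayesian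
   inverses of each other, because a.s.-compatibility turns the dilation
   condition into [samp o t = samp] almost surely. *)

Section Joint.
Variable C : markov_category.

(** Common form of both notions: [as_eq p f g] unfolds to [joint p (idm _) f = joint p (idm _) g],
    and Bayesian inversion equates two joints. *)
Definition joint (A X Y Z : C) (p : A ~> X) (a : X ~> Y) (b : X ~> Z) :
    A ~> Y ⊗ Z :=
  (a ⊠ b) ∘ copy X ∘ p.

Lemma tensor_joint (A X Y Z Y' Z' : C) (p : A ~> X) (a : X ~> Y) (b : X ~> Z)
    (u : Y ~> Y') (v : Z ~> Z') :
  (u ⊠ v) ∘ joint p a b = joint p (u ∘ a) (v ∘ b).
Proof. by rewrite /joint tensor_comp !comp_assoc. Qed.

Lemma joint_map (A X X' Y Z Y' Z' : C) (p : A ~> X) (q : A ~> X')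
    (a : X ~> Y) (b : X ~> Z) (c : X' ~> Y) (d : X' ~> Z)
    (u : Y ~> Y') (v : Z ~> Z') :
  joint p a b = joint q c d ->
  joint p (u ∘ a) (v ∘ b) = joint q (u ∘ c) (v ∘ d).
Proof. by move=> e; rewrite -!tensor_joint e. Qed.

Lemma swap_joint (A X Y Z : C) (p : A ~> X) (a : X ~> Y) (b : X ~> Z) :
  swap Y Z ∘ joint p a b = joint p b a.
Proof.
by rewrite /joint !comp_assoc swap_nat -(comp_assoc _ (swap X X)) copy_comm.
Qed.

Lemma joint_sym (A X X' Y Z : C) (p : A ~> X) (q : A ~> X')
    (a : X ~> Y) (b : X ~> Z) (c : X' ~> Y) (d : X' ~> Z) :
  joint p a b = joint q c d -> joint p b a = joint q d c.
Proof. by move=> e; rewrite -swap_joint e swap_joint. Qed.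

Lemma joint_det (A X X' Y Z : C) (p : A ~> X) (s : X ~> X')
    (a : X' ~> Y) (b : X' ~> Z) :
  deterministic s -> joint (s ∘ p) a b = joint p (a ∘ s) (b ∘ s).
Proof.
move=> ds.
by rewrite /joint tensor_comp comp_assoc -(comp_assoc _ (copy X')) ds !comp_assoc.
Qed.

Lemma runit_joint (A X Y : C) (p : A ~> X) (a : X ~> Y) :
  runit Y ∘ joint p a (del X) = a ∘ p.
Proof.
rewrite -{1}(comp_idr a) -{1}(comp_idl (del X)) -tensor_joint comp_assoc.
by rewrite runit_nat /joint -comp_assoc !(comp_assoc (runit X)) copy_runit comp_idl.
Qed.

Lemma joint_del_inj (A X X' Y Z : C) (p : A ~> X) (q : A ~> X')
    (a : X ~> Y) (b : X ~> Z) (c : X' ~> Y) (d : X' ~> Z) :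
  joint p a b = joint q c d -> a ∘ p = c ∘ q.
Proof.
move=> /(@joint_map _ _ _ _ _ _ _ _ _ _ _ _ _ (idm Y) (del Z)).
rewrite !comp_idl (del_unique (_ ∘ b)) (del_unique (_ ∘ d)) => e.
by rewrite -(runit_joint p a) e runit_joint.
Qed.

Lemma deterministic_id (X : C) : deterministic (idm X).
Proof. by rewrite /deterministic comp_idr tensor_id comp_idl. Qed.

Lemma deterministic_comp (X Y Z : C) (s : Y ~> Z) (r : X ~> Y) :
  deterministic s -> deterministic r -> deterministic (s ∘ r).
Proof.
move=> ds dr; rewrite /deterministic comp_assoc ds -comp_assoc dr comp_assoc.
by rewrite tensor_comp.
Qed.

Lemma bayesian_inverseE (Theta X : C) (m : unit_obj ~> Theta) (f : Theta ~> X)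
    (f' : X ~> Theta) :
  is_bayesian_inverse m f f' <->
  joint m f (idm Theta) = joint (f ∘ m) (idm X) f'.
Proof. by rewrite /is_bayesian_inverse /joint comp_assoc. Qed.

Lemma runit_invE (X : C) : runit_inv X = (idm X ⊠ del X) ∘ copy X.
Proof.
rewrite -[RHS]comp_idl -runitK -comp_assoc (comp_assoc (runit X)) copy_runit.
by rewrite comp_idr.
Qed.

Lemma runit_inv_nat (X Y : C) (f : X ~> Y) :
  (f ⊠ idm unit_obj) ∘ runit_inv X = runit_inv Y ∘ f.
Proof.
rewrite -[LHS]comp_idl -runitK -comp_assoc (comp_assoc (runit Y)) runit_nat.
by rewrite -(comp_assoc f) runit_invK comp_idr.
Qed.

(** Condition the joint state of observation and parameter on the observation; only the [unit_obj]
    input has to be removed. *)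
Lemma bayesian_inverse_exists (Theta X : C) (m : unit_obj ~> Theta)
    (f : Theta ~> X) :
  has_conditionals C -> exists f', is_bayesian_inverse m f f'.
Proof.
move=> hcond; have [k hk] := hcond _ _ _ (joint m f (idm Theta)).
(* The unit wire of the conditional is obtained by deleting a copy of [X], so
   that coassociativity replaces coherence for the unit. *)
exists (k ∘ (idm X ⊠ del X) ∘ copy X).
apply/bayesian_inverseE; rewrite [LHS]hk.
rewrite -(comp_assoc (runit X)) tensor_joint comp_idl comp_idr runit_joint.
(* By terminality [del unit_obj] is the identity, so this is [runit_invE] at the unit. *)
have -> : copy unit_obj = runit_inv unit_obj :> (@unit_obj C ~> _).
  by rewrite runit_invE -(del_unique (idm unit_obj)) tensor_id comp_idl.
rewrite -comp_assoc runit_inv_nat runit_invE.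
rewrite /joint.
have tl (A B B' B'' : C) (u : B' ~> B'') (v : B ~> B') :
    idm A ⊠ (u ∘ v) = (idm A ⊠ u) ∘ (idm A ⊠ v).
  by rewrite -tensor_comp comp_idl.
rewrite !tl -!comp_assoc; congr (_ ∘ _).
rewrite (comp_assoc (idm X ⊠ copy X)) -copy_assoc !comp_assoc; do 3!congr (_ ∘ _).
rewrite -assoc_nat -!comp_assoc; congr (_ ∘ _).
by rewrite -!tensor_comp tensor_id !comp_idl !comp_idr.
Qed.

Lemma discrete_joint_eq (Theta : C) (m : unit_obj ~> Theta) (A : C)
    (f g : Theta ~> A) :
  discrete m -> joint m f (idm Theta) = joint m g (idm Theta) -> f = g.
Proof. by move=> hd e; apply/hd; apply: joint_sym e. Qed.

Lemma more_informative_trans (Theta X Y Z : C) (f : Theta ~> X) (g : Theta ~> Y)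
    (h : Theta ~> Z) :
  more_informative f g -> more_informative g h -> more_informative f h.
Proof.
by move=> [c <-] [d <-]; exists (d ∘ c); rewrite comp_assoc.
Qed.

End Joint.

Section StandardExperiment.
Variables (C : markov_category) (R : representation C).

(** Being deterministic, [sharp R f'] moves from the state into both legs; sampling then turns it
    back into [f']. *)
Lemma standard_experiment_bayesian (Theta X : C) (m : unit_obj ~> Theta)
    (f : Theta ~> X) (fhat : Theta ~> P R Theta) :
  is_standard_experiment m f fhat ->
  is_bayesian_inverse m fhat (samp R Theta).
Proof.
move=> [f' [/bayesian_inverseE hf ->]]; apply/bayesian_inverseE.
rewrite -comp_assoc (joint_det _ _ _ (sharp_det R f')).
have := joint_map (sharp R f') (idm Theta) hf.
by rewrite sharpK !comp_idl comp_idr.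
Qed.

Lemma standard_experiment_le (Theta X : C) (m : unit_obj ~> Theta)
    (f : Theta ~> X) (fhat : Theta ~> P R Theta) :
  is_standard_experiment m f fhat -> more_informative f fhat.
Proof. by move=> [f' [_ ->]]; exists (sharp R f'). Qed.

Lemma standard_experiment_sufficient (Theta X : C) (m : unit_obj ~> Theta)
    (f : Theta ~> X) (fhat : Theta ~> P R Theta) :
  has_conditionals C -> discrete m ->
  is_standard_experiment m f fhat -> more_informative fhat f.
Proof.
move=> hcond hdiscr hf.
have /bayesian_inverseE hs := standard_experiment_bayesian hf.
case: hf hs => f' [/bayesian_inverseE hf ->] hs.
have [h /bayesian_inverseE hh] :=
  bayesian_inverse_exists (f ∘ m) (sharp R f') hcond.
exists h; apply: discrete_joint_eq hdiscr _.
(* Both sides equal the joint of [h] and [samp] over the law of the statistic: the left by [hs], the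
   right by [hh] and [hf]. *)
have := joint_map h (idm Theta) hs; rewrite !comp_idl comp_idr => ->.
have := joint_map (idm X) (samp R Theta) (joint_sym hh).
by rewrite sharpK !comp_idl comp_idr hf comp_assoc => ->.
Qed.

(** A deterministic map into [P R Theta] is the [sharp] of its composite with [samp]. Both sides of
    the dilation equation are of this kind, so compatibility strips [sharp]. *)
Lemma dilationE (Theta : C) (q : unit_obj ~> P R Theta)
    (t : P R Theta ~> P R Theta) :
  as_compatible R ->
  is_dilation q t <-> as_eq q (samp R Theta ∘ t) (samp R Theta).
Proof.
move=> hcompat; rewrite /is_dilation.
have -> : P_hom R (samp R Theta) ∘ sharp R t = sharp R (samp R Theta ∘ t).
  have ds : deterministic (P_hom R (samp R Theta) ∘ sharp R t).
    by apply: deterministic_comp; apply: sharp_det.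
  rewrite -(sampK ds).
  by rewrite /P_hom comp_assoc sharpK -comp_assoc sharpK.
have -> : idm (P R Theta) = sharp R (samp R Theta).
  by rewrite -{1}(sampK (@deterministic_id _ (P R Theta))) comp_idr.
exact: hcompat.
Qed.

Lemma more_informative_dominates (Theta : C) (m : unit_obj ~> Theta)
    (e d : Theta ~> P R Theta) :
  as_compatible R -> has_conditionals C ->
  is_bayesian_inverse m e (samp R Theta) ->
  is_bayesian_inverse m d (samp R Theta) ->
  more_informative e d -> second_order_dominates (d ∘ m) (e ∘ m).
Proof.
move=> hcompat hcond /bayesian_inverseE he /bayesian_inverseE hd [k kE].
have [t /bayesian_inverseE ht] := bayesian_inverse_exists (e ∘ m) k hcond.
rewrite comp_assoc kE in ht; exists t; split.
  (* Both sides equal the joint of [k] and [samp] over [e ∘ m]: one by [ht], the other by [hd] and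
     [he]. *)
  apply/dilationE => //; rewrite /as_eq -/(joint _ _ _) -/(joint _ _ _) -hd.
  have := joint_map (idm _) (samp R Theta) ht.
  rewrite !comp_idl comp_idr => <-.
  have := joint_map k (idm _) he.
  by rewrite kE !comp_idl comp_idr => ->.
(* The marginals of [ht] on the side of [t] give [e ∘ m = t ∘ (d ∘ m)]. *)
by rewrite -(joint_del_inj (joint_sym ht)) comp_idl.
Qed.

Lemma dominates_more_informative (Theta : C) (m : unit_obj ~> Theta)
    (e d : Theta ~> P R Theta) :
  as_compatible R -> has_conditionals C -> discrete m ->
  is_bayesian_inverse m e (samp R Theta) ->
  is_bayesian_inverse m d (samp R Theta) ->
  second_order_dominates (d ∘ m) (e ∘ m) -> more_informative e d.
Proof.
move=> hcompat hcond hdiscr /bayesian_inverseE he /bayesian_inverseE hd.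
move=> [t [/(dilationE _ _ hcompat) dil etE]].
have [k /bayesian_inverseE hk] := bayesian_inverse_exists (d ∘ m) t hcond.
rewrite -etE in hk; exists k; apply: discrete_joint_eq hdiscr _.
(* By [he] and then [hk], the joint of [k ∘ e] with the parameter becomes that of [idm] and
   [samp ∘ t] over [d ∘ m], where [dil] removes [t]. *)
have := joint_map k (idm _) he; rewrite !comp_idl comp_idr => ->.
have := joint_map (idm _) (samp R Theta) (joint_sym hk).
rewrite !comp_idl comp_idr => <-.
by rewrite hd; exact: dil.
Qed.

End StandardExperiment.

Theorem corollary5p15 (C : markov_category) (R : representation C)
  (hcompat : as_compatible R) (hcond : has_conditionals C)
  (Theta : C) (m : unit_obj ~> Theta) (hdiscr : discrete m)
  (X Y : C) (f : Theta ~> X) (g : Theta ~> Y)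
  (fhat ghat : Theta ~> P R Theta)
  (hfhat : is_standard_experiment m f fhat)
  (hghat : is_standard_experiment m g ghat) :
  more_informative f g <-> second_order_dominates (ghat ∘ m) (fhat ∘ m).
Proof.
have bf := standard_experiment_bayesian hfhat.
have bg := standard_experiment_bayesian hghat.
split=> h.
  (* Informativeness decreases along [fhat], [f], [g], [ghat]. *)
  apply: more_informative_dominates => //.
  apply: more_informative_trans (standard_experiment_le hghat).
  exact: more_informative_trans (standard_experiment_sufficient _ _ hfhat) h.
(* Here the chain is [f], [fhat], [ghat], [g]. *)
apply: more_informative_trans (standard_experiment_le hfhat) _.
apply: more_informative_trans (standard_experiment_sufficient _ _ hghat) => //.
exact: dominates_more_informative h.
Qed.
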